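(* Let $G$ be a finite graph (multiple edges allowed) with vertex set $V$ and edge set $E$, each edge $e$ joining two distinct vertices $v_1(e),v_2(e)$, and every vertex $v$ having degree $d_v>0$. For each $v\in V$ let $C(v)$ be a finite nonempty set of nonnegative integers, let $(C)$ be the set of subsets $M\subset E$ with $d_M(v)\in C(v)$ for all $v$ (where $d_M(v)$ is the number of edges of $M$ incident to $v$), assume $(C)\ne\emptyset$, and let $P_{(C)}(z)=\sum_{M\in(C)}z^{|M|}$. For $v\in V$ let $p_v(z)=\sum_{k\in C(v)}\binom{d_v}{k}z^k$. Suppose that for each $v\in V$ there is a constant $r_v>0$ such that every root $\zeta$ of $p_v$ satisfies $|\zeta|\ge r_v$. Then every root $\xi$ of $P_{(C)}$ satisfies $|\xi|\ge R$, where $R=\min_{e\in E}r_{v_1(e)}r_{v_2(e)}$. *)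

(* Defs.v *)
From mathcomp Require Import all_boot all_order all_algebra finmap.
From mathcomp Require Import complex.
From mathcomp Require Import reals constructive_ereal.

Set Implicit Arguments.
Unset Strict Implicit.
Unset Printing Implicit Defensive.

Import Order.TTheory GRing.Theory Num.Theory.
Local Open Scope ring_scope.
Local Open Scope complex_scope.

(* A multigraph is given by its edge type E and the endpoint maps v1, v2;
   distinct elements of E with the same endpoints are parallel edges. *)
Definition degree_in (V E : finType) (v1 v2 : E -> V) (M : {set E}) (v : V) :
    nat :=
  #|[set e in M | (v1 e == v) || (v2 e == v)]|.

Definition degree (V E : finType) (v1 v2 : E -> V) (v : V) : nat :=
  degree_in v1 v2 [set: E] v.

Definition admissible (V E : finType) (v1 v2 : E -> V) (C : V -> {fset nat}) :
    {set {set E}} :=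
  [set M : {set E} | [forall v : V, degree_in v1 v2 M v \in C v]].

Definition subgraph_poly (R : realType) (V E : finType) (v1 v2 : E -> V)
    (C : V -> {fset nat}) : {poly R[i]} :=
  \sum_(M in admissible v1 v2 C) 'X^#|M|.

Definition vertex_poly (R : realType) (V E : finType) (v1 v2 : E -> V)
    (C : V -> {fset nat}) (v : V) : {poly R[i]} :=
  \sum_(k <- C v) 'C(degree v1 v2 v, k)%:R *: 'X^k.

(* Taken in the extended reals so that the minimum over an empty edge set,
   which under positive degrees forces V to be empty, is +oo. *)
Definition min_edge_radius (R : realType) (V E : finType) (v1 v2 : E -> V)
    (r : V -> R) : \bar R :=
  \big[Order.min/+oo%E]_(e : E) (r (v1 e) * r (v2 e))%:E.

(* Main.v *)
Require Import Defs.
From mathcomp Require Import all_boot all_order all_algebra finmap.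
From mathcomp Require Import complex ring.
From mathcomp Require Import reals constructive_ereal.

Set Implicit Arguments.
Unset Strict Implicit.
Unset Printing Implicit Defensive.

Import Order.TTheory GRing.Theory Num.Theory.
Local Open Scope ring_scope.

(* Splitting every edge into two half-edges with independent variables turns the
   generating function into a product over the vertices of symmetric
   multiaffine polynomials, the vertex [v] contributing the polarization of
   [p_v]. By Grace-Walsh-Szego this polarization does not vanish when all its
   variables lie in the open disc of radius [r v]. Identifying the two halves of
   an edge is an Asano contraction [a + b x + c y + d x y |-> a + d z], which
   keeps the polynomial nonzero for [z] in the disc whose radius is the product
   of the two radii; contracting all edges gives [P_(C)]. *)

(** * Polarization, Grace-Walsh-Szego for discs, Asano contraction *)

Section Polarization.
Variable F : numClosedFieldType.
Implicit Types (c : nat -> F) (s : seq F) (r a z w : F) (p : {poly F}).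

(* The condition on [w] describes the image of the exterior of the disc of radius
   [r] under [t |-> (a - t) / (z - t)]. It reads [0 <= f w] for a concave
   quadratic [f] with [f 0 < 0], so summing [f] over a list of sum [0] gives a
   negative value. *)
Lemma sum_moebius_neq0 r a z (ws : seq F) :
  `|a| < r -> `|z| < r -> (0 < size ws)%N ->
  (forall w, w \in ws -> r * `|1 - w| <= `|a - w * z|) ->
  \sum_(w <- ws) w != 0.
Proof.
move=> ar zr ws_gt0 wsP; apply/eqP => sum0.
have r_gt0 : 0 < r by apply: le_lt_trans ar.
have sqlt (x : F) : `|x| < r -> `|x| ^+ 2 - r ^+ 2 < 0.
  by move=> xr; rewrite subr_lt0 ltr_pXn2r // nnegrE // ltW.
pose f w : F := `|a - w * z| ^+ 2 - (r * `|1 - w|) ^+ 2.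
have fE w : f w = (`|a| ^+ 2 - r ^+ 2) + (r ^+ 2 - a^* * z) * w
    + (r ^+ 2 - a * z^*) * w^* + (`|z| ^+ 2 - r ^+ 2) * `|w| ^+ 2.
  rewrite /f exprMn !normCK !(rmorphB, rmorphM, rmorph1) /=; ring.
have : 0 <= \sum_(w <- ws) f w.
  rewrite big_seq sumr_ge0 // => w /wsP wP.
  by rewrite subr_ge0 lerXn2r // nnegrE // mulr_ge0 // ltW.
move: (sqlt _ ar) (sqlt _ zr) fE.
move: (`|a| ^+ 2 - _) (`|z| ^+ 2 - _) => A B A_lt0 B_lt0 fE.
under eq_bigr do rewrite fE.
rewrite !big_split /= -!mulr_sumr -rmorph_sum sum0 rmorph0 !mulr0 !addr0.
apply/negP; rewrite lt_geF //.
rewrite big_const_seq count_predT iter_addr_0 -[X in _ < X]addr0.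
apply: ltr_leD; first by rewrite pmulrn_llt0.
rewrite mulr_le0_ge0 ?(ltW B_lt0) //.
by apply: sumr_ge0 => *; rewrite exprn_ge0.
Qed.

Lemma horner_deriv_prod_XsubC (rs : seq F) z : z \notin rs ->
  (\prod_(t <- rs) ('X - t%:P))^`().[z] =
  (\prod_(t <- rs) ('X - t%:P)).[z] * \sum_(t <- rs) (z - t)^-1.
Proof.
elim: rs => [|t rs IH]; first by rewrite !big_nil derivC horner0 mulr0.
rewrite inE negb_or => /andP[zt /IH {}IH].
rewrite !big_cons derivM derivXsubC mul1r hornerD !hornerM IH hornerXsubC.
have : z - t != 0 by rewrite subr_eq0.
by move=> ?; field.
Qed.

(* Laguerre's theorem on the polar derivative, for a disc. *)
Lemma polar_derivative_neq0 r p n a z :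
  (size p <= n.+1)%N -> (0 < n)%N -> (forall t, `|t| < r -> p.[t] != 0) ->
  `|a| < r -> `|z| < r -> n%:R * p.[z] + (a - z) * p^`().[z] != 0.
Proof.
move=> sp n_gt0 p_neq0 ar zr.
have [rs Ep] := closed_field_poly_normal p.
have pz := p_neq0 z zr.
have p0 : p != 0 by apply: contraNneq pz => ->; rewrite horner0.
have rsP t : t \in rs -> ~~ (`|t| < r).
  move=> trs; apply: contraL (isT) => /p_neq0.
  rewrite -[_.[t] == 0]/(root p t) Ep rootZ ?lead_coef_eq0 //.
  by rewrite root_prod_XsubC trs.
have zrs : z \notin rs by apply: contraL zr => /rsP.
have srs : (size rs <= n)%N.
  move: sp; rewrite Ep size_scale ?lead_coef_eq0 // size_prod_XsubC //.
have -> : p^`().[z] = p.[z] * \sum_(t <- rs) (z - t)^-1.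
  by rewrite Ep derivZ !hornerZ horner_deriv_prod_XsubC // mulrA.
(* The entries [1] account for the missing roots, i.e. the roots at infinity. *)
pose ws := nseq (n - size rs) 1 ++ [seq (a - t) / (z - t) | t <- rs].
have zt t : t \in rs -> z - t != 0.
  by move=> trs; rewrite subr_eq0; apply: contraNneq zrs => ->.
have -> : n%:R * p.[z] + (a - z) * (p.[z] * \sum_(t <- rs) (z - t)^-1) =
          p.[z] * \sum_(w <- ws) w.
  rewrite big_cat big_map big_nseq iter_addr_0 /=.
  have -> : \sum_(t <- rs) (a - t) / (z - t)
            = (size rs)%:R + (a - z) * \sum_(t <- rs) (z - t)^-1.
    rewrite mulr_sumr -sum1_size natr_sum -big_split /=.
    rewrite !big_seq; apply: eq_bigr => t /zt zt0; by field.
  rewrite natrB //; ring.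
rewrite mulf_neq0 //; apply: (@sum_moebius_neq0 r a z) => //.
  by rewrite size_cat size_nseq size_map subnK.
move=> w; rewrite mem_cat => /orP[|/mapP[t trs ->]].
  by rewrite mem_nseq => /andP[_ /eqP ->]; rewrite subrr normr0 mulr0.
have zt0 := zt t trs.
(* Both sides of the bound carry the factor [(z - a) / (z - t)]; what remains is that the root [t]
   has modulus at least [r]. *)
have -> : 1 - (a - t) / (z - t) = (z - a) / (z - t) by field.
have -> : a - (a - t) / (z - t) * z = t * ((z - a) / (z - t)) by field.
rewrite [X in _ <= X]normrM ler_wpM2r // real_leNgt ?rsP ?normr_real //.
by rewrite gtr0_real // (le_lt_trans _ ar).
Qed.

(* [polarization c [:: x1; ..; xn]] is the sum over [S] of [c #|S|] times the
   product of the [x_i], [i] in [S]. *)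
Fixpoint polarization c s : F :=
  if s is x :: s' then
    polarization c s' + x * polarization (fun k => c k.+1) s'
  else c 0%N.

(** This is the polynomial with coefficients ['C(n, k) * c k]; its recursion copies that of
    [polarization], so the two are compared without binomial identities. *)
Fixpoint diagonal_poly c n : {poly F} :=
  if n is n'.+1 then
    diagonal_poly c n' + 'X * diagonal_poly (fun k => c k.+1) n'
  else (c 0%N)%:P.

Lemma horner_diagonal_poly c n z :
  (diagonal_poly c n).[z] = polarization c (nseq n z).
Proof.
elim: n c => [|n IH] c /=; first by rewrite hornerC.
by rewrite hornerD hornerM hornerX !IH.
Qed.

Lemma size_diagonal_poly c n : (size (diagonal_poly c n) <= n.+1)%N.
Proof.
elim: n c => [|n IH] c /=; first exact: size_polyC_leq1.
rewrite (leq_trans (size_polyD _ _)) // geq_max (leq_trans (IH _)) //=.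
by rewrite (leq_trans (size_polyMleq _ _)) // size_polyX ltnS.
Qed.

Lemma deriv_diagonal_poly c n :
  (diagonal_poly c n.+1)^`() = n.+1%:R *: diagonal_poly (fun k => c k.+1) n.
Proof.
elim: n c => [|n IH] c.
  by rewrite /= derivD derivM derivX !derivC mulr0 add0r addr0 mul1r scale1r.
rewrite [diagonal_poly c _]/= derivD -/(diagonal_poly c n.+1) IH.
rewrite derivM derivX mul1r -/(diagonal_poly (fun k => c k.+1) n.+1) IH.
rewrite [n.+2%:R]mulrS scalerDl scale1r /= -scalerAr scalerDr; ring.
Qed.

Lemma polarizationD c d x s :
  polarization (fun k => c k + x * d k) s = polarization c s + x * polarization d s.
Proof. by elim: s c d => [|y s IH] c d //=; rewrite !IH; ring. Qed.

(* Grace-Walsh-Szego for discs: fixing one variable of the polarization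
   replaces the diagonal polynomial by its polar derivative. *)
Lemma polarization_neq0 r c s : 0 < r ->
  (forall z, `|z| < r -> polarization c (nseq (size s) z) != 0) ->
  (forall x, x \in s -> `|x| < r) -> polarization c s != 0.
Proof.
move=> r_gt0; elim: s c => [|x s IH] c diag sr.
  by apply: (diag 0); rewrite normr0.
have xr : `|x| < r by apply: sr; rewrite mem_head.
rewrite /= -polarizationD; apply: IH => [z zr|y ys]; last first.
  by apply: sr; rewrite inE ys orbT.
have := @polar_derivative_neq0 r (diagonal_poly c (size s).+1) (size s).+1 x z.
rewrite size_diagonal_poly deriv_diagonal_poly => /(_ isT isT).
have diag' t : `|t| < r -> (diagonal_poly c (size s).+1).[t] != 0.
  by move=> tr; rewrite horner_diagonal_poly diag.
(* The terms in [z] cancel: the polar derivative is the nonzero factor [(size s).+1] times the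
   polarization of [c k + x * c k.+1] on the diagonal. *)
move=> /(_ diag' xr zr); rewrite hornerZ !horner_diagonal_poly /=.
rewrite polarizationD mulrCA -mulrDr mulf_eq0 pnatr_eq0 /=.
by congr (_ != 0); ring.
Qed.

(* With [x = r1 t], [y = r2 t] the form becomes a quadratic in [t] whose roots
   have product [a / (d r1 r2)]. *)
Lemma asano_contraction (r1 r2 a b c d z : F) : 0 < r1 -> 0 < r2 ->
  (forall x y, `|x| < r1 -> `|y| < r2 -> a + b * x + c * y + d * (x * y) != 0) ->
  `|z| < r1 * r2 -> a + d * z != 0.
Proof.
move=> r1_gt0 r2_gt0 nz zr; apply/eqP => adz.
have a0 : a != 0 by have := nz 0 0; rewrite normr0 !mulr0 !addr0; apply.
have d0 : d != 0.
  by apply: contra_neq a0 => d0; move: adz; rewrite d0 mul0r addr0.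
have r10 : r1 != 0 by rewrite gt_eqF.
have r20 : r2 != 0 by rewrite gt_eqF.
have {}adz : a = - (d * z) by apply/eqP; rewrite -addr_eq0 adz.
pose B := (b * r1 + c * r2) / (d * r1 * r2); pose A := - z / (r1 * r2).
have nzt t : `|t| < 1 -> t ^+ 2 + B * t + A != 0.
  move=> t1; have := nz (r1 * t) (r2 * t).
  rewrite !normrM (gtr0_norm r1_gt0) (gtr0_norm r2_gt0) !gtr_pMr // => /(_ t1 t1).
  apply: contraNneq => tE.
  rewrite -(mulr0 (d * r1 * r2)) -tE adz /A /B; apply/eqP; field.
  by rewrite d0 r10 r20.
have [t tE] := @solve_monicpoly F 2 (fun i => if i == 0%N then - A else - B) isT.
rewrite 2!big_ord_recl big_ord0 /= expr0 expr1 mulr1 addr0 in tE.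
have t1 : ~~ (`|t| < 1).
  by apply/negP => /nzt; rewrite tE; apply/negP; rewrite negbK; apply/eqP; ring.
(* By Vieta [- B - t] is the other root; two roots of modulus at least 1 contradict the product [A]
   of modulus below 1. *)
have t2 : ~~ (`|- B - t| < 1).
  apply/negP => /nzt; apply/negP; rewrite negbK; apply/eqP.
  by transitivity (t ^+ 2 + B * t + A); [ring | rewrite tE; ring].
have tA : t * (- B - t) = A.
  by rewrite mulrBr -expr2 tE; ring.
have : `|A| < 1.
  rewrite /A normrM normrN normfV (gtr0_norm (mulr_gt0 r1_gt0 r2_gt0)).
  by rewrite ltr_pdivrMr ?mulr_gt0 // mul1r.
apply/negP; rewrite -tA normrM -real_leNgt ?real1 ?normr_real //; last first.
  by rewrite realM ?normr_real.
by rewrite -[X in X <= _]mulr1 ler_pM // real_leNgt ?real1 ?normr_real.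
Qed.

(** Subsets avoiding the head [a] give the first summand of the recursion; those containing it are
    the [a |: S], whose extra element contributes [X a] and shifts the index of [c]. *)
Lemma sum_subset_polarization (H : finType) (X : H -> F) c (s : seq H) : uniq s ->
  \sum_(S : {set H} | S \subset s) c #|S| * \prod_(h in S) X h =
  polarization c (map X s).
Proof.
elim: s c => [|a s IH] c /= => [_|/andP[as_ us]].
  rewrite (big_pred1 set0) => [|S]; first by rewrite cards0 big_set0 mulr1.
  apply/subsetP/eqP => [S0|-> h]; last by rewrite inE.
  by apply/setP => h; rewrite inE; apply/negP => /S0.
rewrite (bigID [pred S : {set H} | a \in S]) /= addrC; congr (_ + _).
  rewrite -IH //; apply: eq_bigl => S; apply/andP/subsetP.
    move=> [/subsetP Ss aS] h hS; have := Ss _ hS; rewrite inE => /orP[/eqP ha|//].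
    by rewrite -ha hS in aS.
  move=> Ss; split; last by apply: contra as_ => /Ss.
  by apply/subsetP => h /Ss hs; rewrite inE hs orbT.
rewrite -IH // mulr_sumr.
rewrite (reindex_onto (fun S => a |: S) (fun S => S :\ a)) /=; last first.
  by move=> S /andP[_ aS]; rewrite setD1K.
have PE S : [&& a |: S \subset a :: s, a \in a |: S & (a |: S) :\ a == S]
    = (S \subset s).
  rewrite setU11 /=; apply/andP/subsetP => [[/subsetP Ss /eqP Sa] h hS|Ss].
    have : h \in (a |: S) :\ a by rewrite Sa.
    rewrite !inE => /andP[ha _]; have := Ss h; rewrite !inE hS orbT (negbTE ha).
    exact.
  split; last by rewrite setU1K //; apply: contra as_ => /Ss.
  by apply/subsetP => h; rewrite !inE => /orP[->//|/Ss ->]; rewrite orbT.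
rewrite (eq_bigl _ _ (fun S => etrans (esym (andbA _ _ _)) (PE S))).
apply: eq_bigr => S Ss; have aS : a \notin S.
  by apply: contra as_ => /(subsetP Ss).
by rewrite cardsU1 aS big_setU1 //= add1n; ring.
Qed.

(** Pascal's rule matches the recursion. *)
Lemma polarization_nseq c n z :
  polarization c (nseq n z) = \sum_(k < n.+1) 'C(n, k)%:R * c k * z ^+ k.
Proof.
elim: n c => [|n IH] c; first by rewrite big_ord1 /= bin0 expr0; ring.
rewrite /= !IH [RHS]big_ord_recl /= bin0 expr0.
under [in RHS]eq_bigr => i _ do
  rewrite /bump /= add1n binS natrD !mulrDl.
rewrite big_split /= addrA mulr_sumr; congr (_ + _); last first.
  by apply: eq_bigr => i _; rewrite exprS; ring.
rewrite big_ord_recl /= bin0 expr0; congr (_ + _).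
rewrite [RHS]big_ord_recr /= bin_small // !mul0r addr0.
by apply: eq_bigr => i _; rewrite exprS; ring.
Qed.
End Polarization.

(** * Half-edge sums and the contraction of all edges *)

Section HalfEdges.
Variables (F : numClosedFieldType) (E : finType).
Implicit Types (w : {set E * bool} -> F) (f : E -> bool -> bool -> F) (z : E -> F).

(** The weight [f e] sees both halves of [e] at once, so one form covers independent half-edge
    variables and contracted edges. *)
Definition halfedge_sum w f : F :=
  \sum_(T : {set E * bool})
    w T * \prod_e f e ((e, false) \in T) ((e, true) \in T).

(** The sum is linear in the four values of [f e0]; this is the coefficient of [f e0 b.1 b.2]. *)
Definition halfedge_coef w f (e0 : E) (b : bool * bool) : F :=
  \sum_(T : {set E * bool} | ((e0, false) \in T, (e0, true) \in T) == b)
    w T * \prod_(e | e != e0) f e ((e, false) \in T) ((e, true) \in T).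

Lemma eq_halfedge_coef w f g e0 b : (forall e, e != e0 -> f e =2 g e) ->
  halfedge_coef w f e0 b = halfedge_coef w g e0 b.
Proof.
move=> fg; apply: eq_bigr => T _; congr (_ * _).
by apply: eq_bigr => e /fg ->.
Qed.

Lemma halfedge_sum_split w f e0 (k := halfedge_coef w f e0) :
  halfedge_sum w f =
  k (false, false) * f e0 false false + k (true, false) * f e0 true false
  + k (false, true) * f e0 false true + k (true, true) * f e0 true true.
Proof.
rewrite /halfedge_sum.
rewrite (partition_big (fun T : {set E * bool} =>
  ((e0, false) \in T, (e0, true) \in T)) predT) //=.
have -> (G : bool * bool -> F) : \sum_b G b =
    G (false, false) + G (true, false) + G (false, true) + G (true, true).
  rewrite -(eq_bigr _ (fun b _ => congr1 G (esym (surjective_pairing b)))).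
  by rewrite -(pair_bigA _ (fun a b => G (a, b))) /= !big_bool /=; ring.
have split_e0 b : \sum_(T : {set E * bool} |
      ((e0, false) \in T, (e0, true) \in T) == b)
    w T * \prod_e f e ((e, false) \in T) ((e, true) \in T)
  = k b * f e0 b.1 b.2.
  rewrite /k /halfedge_coef mulr_suml; apply: eq_bigr => T /eqP Tb.
  by rewrite (bigD1 e0) //= -Tb /=; ring.
by rewrite !split_e0.
Qed.

(* The edges in [s] are contracted: the two halves are chosen together, with
   weight [z e]; the other edges keep independent half-edge variables. *)
Definition contracted_weight (s : seq E) (X : E * bool -> F) z (e : E)
    (b1 b2 : bool) : F :=
  if e \in s then if b1 == b2 then z e ^+ b1 else 0
  else X (e, false) ^+ b1 * X (e, true) ^+ b2.

Lemma halfedge_sum_contracted_neq0 w (rho : E * bool -> F) z (s : seq E) X :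
  (forall h, 0 < rho h) ->
  (forall X, (forall h, `|X h| < rho h) ->
     halfedge_sum w (contracted_weight [::] X z) != 0) ->
  (forall e, `|z e| < rho (e, false) * rho (e, true)) ->
  (forall h, `|X h| < rho h) ->
  halfedge_sum w (contracted_weight s X z) != 0.
Proof.
move=> rho_gt0 nz zr; elim: s X => [|e0 s IH] X Xr; first exact: nz.
(* The induction hypothesis holds for all [X], so the two variables of [e0] can range freely over
   their discs. *)
pose X' x y h := if h.1 == e0 then if h.2 then y else x else X h.
pose k := halfedge_coef w (contracted_weight (e0 :: s) X z) e0.
have := IH X Xr.
case: (boolP (e0 \in s)) => e0s.
  congr (_ != 0); apply: eq_bigr => T _; congr (_ * _); apply: eq_bigr => e _.
  by rewrite /contracted_weight inE; case: (eqVneq e e0) => // ->; rewrite e0s.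
move=> _; rewrite (halfedge_sum_split w _ e0) -/k /contracted_weight mem_head /=.
rewrite expr0 expr1 mulr1 !mulr0 !addr0.
(* Contraction gave the mixed coefficients weight 0, so they no longer occur in the goal and are
   supplied by hand. *)
apply: (@asano_contraction _ (rho (e0, false)) (rho (e0, true)) _
  (k (true, false)) (k (false, true))) => // x y xr yr.
have := IH (X' x y); rewrite (halfedge_sum_split w _ e0).
have kE b : halfedge_coef w (contracted_weight s (X' x y) z) e0 b = k b.
  apply: eq_halfedge_coef => e ee0 b1 b2; rewrite /contracted_weight inE.
  by rewrite (negbTE ee0) /X' /= (negbTE ee0).
rewrite !kE /contracted_weight (negbTE e0s) /X' /= eqxx !expr0 !expr1 !mulr1 mul1r.
by apply=> -[e []] /=; case: eqVneq => [->|_].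
Qed.

Lemma sum_contracted_neq0 w (rho : E * bool -> F) z :
  (forall h, 0 < rho h) ->
  (forall X, (forall h, `|X h| < rho h) ->
     \sum_(T : {set E * bool}) w T * \prod_(h in T) X h != 0) ->
  (forall e, `|z e| < rho (e, false) * rho (e, true)) ->
  \sum_(M : {set E}) w [set h | h.1 \in M] * \prod_(e in M) z e != 0.
Proof.
move=> rho_gt0 nz zr.
have := @halfedge_sum_contracted_neq0 w rho z (enum E) (fun=> 0) rho_gt0.
have weight0 X (T : {set E * bool}) : \prod_e contracted_weight [::] X z e
    ((e, false) \in T) ((e, true) \in T) = \prod_(h in T) X h.
  rewrite [RHS]big_mkcond.
  transitivity (\prod_e \prod_(b : bool) if (e, b) \in T then X (e, b) else 1).
    apply: eq_bigr => e _; rewrite /contracted_weight in_nil big_bool /= mulrC.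
    by case: (_ \in T); case: (_ \in T).
  by rewrite pair_bigA; apply: eq_bigr => -[].
have nz' X : (forall h, `|X h| < rho h) ->
    halfedge_sum w (contracted_weight [::] X z) != 0.
  move=> Xr; rewrite /halfedge_sum.
  by under eq_bigr do rewrite weight0; apply: nz.
move=> /(_ nz' zr); have zero_lt h : `|0 : F| < rho h by rewrite normr0.
move=> /(_ zero_lt).
congr (_ != 0); rewrite /halfedge_sum.
pose lift (M : {set E}) := [set h : E * bool | h.1 \in M].
(* Any other [T] contains exactly one half of some edge, and that edge has weight 0. *)
rewrite (bigID (fun T : {set E * bool} => T == lift [set e | (e, false) \in T])) /=.
rewrite [X in _ + X]big1 ?addr0 => [|T]; last first.
  move=> TN; rewrite (_ : \prod_e _ = 0) ?mulr0 //; apply/eqP.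
  have [e eP] : exists e, ((e, false) \in T) != ((e, true) \in T).
    apply/existsP; apply: contraNT TN => /existsPn same.
    apply/eqP/setP => -[e b]; rewrite !inE /=.
    by have := same e; rewrite negbK => /eqP; case: b => // ->.
  apply/prodf_eq0; exists e => //.
  by rewrite /contracted_weight mem_enum (negbTE eP).
rewrite (reindex_onto lift (fun T : {set E * bool} =>
  [set e | (e, false) \in T])) /=; last first.
  by move=> T /eqP.
have liftK M : [set e | (e, false) \in lift M] = M.
  by apply/setP => e; rewrite !inE.
apply: eq_big => [M|M _]; first by rewrite liftK !eqxx.
congr (_ * _); rewrite [RHS]big_mkcond; apply: eq_bigr => e _.
by rewrite /contracted_weight mem_enum !inE eqxx /=; case: (e \in M).
Qed.

End HalfEdges.

(** The fibres of [p] partition [H], so choosing a subset of each fibre amounts to choosing one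
    subset [T] of [H]. *)
Lemma prod_sum_fibers (H V : finType) (K : comNzRingType) (p : H -> V)
    (g : V -> {set H} -> K) (fib := fun v => [set h | p h == v]) :
  \prod_v \sum_(S : {set H} | S \subset fib v) g v S =
  \sum_(T : {set H}) \prod_v g v (T :&: fib v).
Proof.
rewrite bigA_distr_big_dep.
rewrite (reindex_onto (fun T : {set H} => [ffun v => T :&: fib v])
   (fun S : {ffun V -> {set H}} => [set h | h \in S (p h)])) /=.
  apply: eq_big => [T|T _]; last by apply: eq_bigr => v _; rewrite ffunE.
  apply/andP; split; first by apply/familyP => v; rewrite ffunE; apply: subsetIr.
  by apply/eqP/setP => h; rewrite inE ffunE !inE eqxx andbT.
move=> S /familyP SP; apply/ffunP => v; rewrite ffunE; apply/setP => h.
rewrite !inE; case: eqVneq => [->|hv]; first by rewrite andbT.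
rewrite andbF; apply/esym/negP => hS; have /subsetP/(_ h hS) := SP v.
by rewrite inE (negbTE hv).
Qed.

Local Open Scope complex_scope.

(** * Degrees and generating polynomials in terms of half-edges *)

Section Graph.
Variables (V E : finType) (v1 v2 : E -> V).

Definition endpoint (h : E * bool) : V := if h.2 then v2 h.1 else v1 h.1.

(** Without loops an edge has at most one half at [v], so [fst] is injective on these half-edges. *)
Lemma degree_in_halfedges (M : {set E}) v : (forall e, v1 e <> v2 e) ->
  #|[set h | h.1 \in M] :&: [set h | endpoint h == v]| = degree_in v1 v2 M v.
Proof.
move=> v12; rewrite /degree_in.
rewrite -(@card_in_imset _ _ fst (_ :&: _)); last first.
  move=> [e b] [e' b'] /[!inE] /andP[_ /eqP eb] /andP[_ /eqP eb'] /= ee'.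
  rewrite -ee' in eb' *; move: eb; rewrite -{}eb' /endpoint /=.
  by case: b b' => -[] // => [/esym|] /v12.
congr #|pred_of_set _|; apply/setP => e; rewrite !inE; apply/imsetP/andP.
  move=> [[e' []]]; rewrite !inE /endpoint /= => /andP[eM /eqP ev] ->; split=> //.
    by rewrite ev eqxx orbT.
  by rewrite ev eqxx.
move=> [eM /orP[/eqP ev|/eqP ev]].
  by exists (e, false) => //; rewrite !inE /endpoint /= eM ev eqxx.
by exists (e, true) => //; rewrite !inE /endpoint /= eM ev eqxx.
Qed.

Lemma horner_vertex_poly (R : realType) (C : V -> {fset nat}) v (z : R[i]) :
  (vertex_poly R v1 v2 C v).[z] =
  polarization (fun k => (k \in C v)%:R) (nseq (degree v1 v2 v) z).
Proof.
rewrite polarization_nseq horner_sum; set d := degree _ _ _.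
under eq_bigr do rewrite hornerZ hornerXn.
pose G k : R[i] := 'C(d, k)%:R * z ^+ k.
(* Elements of [C v] above the degree [d] have binomial coefficient 0. *)
transitivity (\sum_(k <- C v | (k < d.+1)%N) G k).
  rewrite [RHS]big_mkcond; apply: eq_bigr => k _; rewrite /G.
  by case: ltnP => // dk; rewrite bin_small // mul0r.
transitivity (\sum_(0 <= k < d.+1 | k \in C v) G k).
  rewrite -big_filter -[RHS]big_filter; apply: perm_big; apply: uniq_perm.
  - by rewrite filter_uniq // fset_uniq.
  - by rewrite filter_uniq // iota_uniq.
  by move=> k; rewrite !mem_filter mem_index_iota andbC.
rewrite big_mkcond big_mkord; apply: eq_bigr => k _; rewrite /G.
by case: (_ \in _); rewrite ?mulr1 // mulr0 mul0r.
Qed.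

Lemma horner_subgraph_poly (R : realType) (C : V -> {fset nat}) (z : R[i]) :
  (subgraph_poly R v1 v2 C).[z] =
  \sum_(M : {set E})
    (\prod_v (degree_in v1 v2 M v \in C v)%:R) * \prod_(e in M) z.
Proof.
rewrite horner_sum big_mkcond; apply: eq_bigr => M _.
rewrite hornerXn prodr_const inE; case: forallP => [MC|/forallP].
  by rewrite big1 ?mul1r // => v _; rewrite MC.
rewrite negb_forall => /existsP[v vP].
by rewrite (bigD1 v) //= (negbTE vP) !mul0r.
Qed.

End Graph.

Theorem theorem4p1 (R : realType) (V E : finType) (v1 v2 : E -> V)
  (C : V -> {fset nat}) (r : V -> R)
  (endpoints_neq : forall e : E, v1 e <> v2 e)
  (degree_gt0 : forall v : V, (0 < degree v1 v2 v)%N)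
  (C_neq0 : forall v : V, C v <> fset0)
  (admissible_neq0 : admissible v1 v2 C <> set0)
  (r_gt0 : forall v : V, 0 < r v)
  (vertex_roots : forall (v : V) (zeta : R[i]),
     root (vertex_poly R v1 v2 C v) zeta -> r v <= ComplexField.Normc.normc zeta) :
  forall xi : R[i], root (subgraph_poly R v1 v2 C) xi ->
    (min_edge_radius v1 v2 r <= (ComplexField.Normc.normc xi)%:E)%E.
Proof.
move=> xi; rewrite leNgt; apply: contraL => xi_lt.
have {}xi_lt e : ComplexField.Normc.normc xi < r (v1 e) * r (v2 e).
  by rewrite -lte_fin (lt_le_trans xi_lt) // /min_edge_radius bigmin_le_cond.
pose c v k : R[i] := (k \in C v)%:R.
pose fib v := [set h | endpoint v1 v2 h == v].
(* Indicator of the half-edge sets with an allowed number of elements at every vertex; on full lifts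
   of edge sets it is admissibility. *)
pose w (T : {set E * bool}) := \prod_v c v #|T :&: fib v|.
rewrite /root horner_subgraph_poly.
under eq_bigr => M _ do (under eq_bigr => v _ do
  rewrite -(degree_in_halfedges M v endpoints_neq)).
apply: (@sum_contracted_neq0 _ _ w (fun h => (r (endpoint v1 v2 h))%:C)
  (fun=> xi)) => [h|X Xr|e]; last 1 first.
- by rewrite -rmorphM ltcR; apply: xi_lt.
- by rewrite -[0]/(0%:C) ltcR.
have -> : \sum_(T : {set E * bool}) w T * \prod_(h in T) X h =
    \prod_v \sum_(S : {set E * bool} | S \subset fib v)
      c v #|S| * \prod_(h in S) X h.
  rewrite (prod_sum_fibers (endpoint v1 v2)
    (fun v S => c v #|S| * \prod_(h in S) X h)).
  apply: eq_bigr => T _; rewrite big_split; congr (_ * _).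
  rewrite (partition_big (endpoint v1 v2) predT) //=; apply: eq_bigr => v _.
  by apply: eq_bigl => h; rewrite !inE.
apply/prodf_neq0 => v _.
rewrite (eq_bigl (fun S : {set E * bool} => S \subset enum (fib v))); last first.
  by move=> S; apply/subsetP/subsetP => sub h /sub; rewrite mem_enum.
rewrite (sum_subset_polarization X (c v) (enum_uniq _)).
(* On the diagonal the polarization is [p_v], to which [vertex_roots] applies. *)
apply: (@polarization_neq0 _ (r v)%:C); first by rewrite -[0]/(0%:C) ltcR.
  move=> z zr; rewrite size_map -cardE.
  have -> : #|fib v| = degree v1 v2 v.
    rewrite /degree -(degree_in_halfedges _ _ endpoints_neq); congr #|pred_of_set _|.
    by apply/setP => h; rewrite !inE.
  rewrite -horner_vertex_poly; apply: contraTN zr => /vertex_roots.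
  by rewrite ltcR -leNgt.
by move=> x /mapP[h]; rewrite mem_enum inE => /eqP <- ->.
Qed.
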